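(* Let $W:\mathbb{R}_+\times\mathbb{R}\times\mathcal{I}\to\mathbb{R}$ be a separable weighting of the form $W(E,x_1,x_2)=W_1(E)W_2(x_1,x_2)$, where $W_1\in C^1(\mathbb{R}_+)$ and $W_2\in C^1(\mathbb{R}\times\mathcal{I})$ are non-vanishing. Let $W_2$ be symmetric about $x_1=0$ (i.e. $W_2(-x_1,x_2)=W_2(x_1,x_2)$), and further, for any $x_2\in\mathcal{I}$, let $W_2(\cdot,x_2)\in C^1(\mathbb{R})$ be bounded and have bounded first order derivative (in $x_1$) on $[-w(x_2),w(x_2)]$. Then the Bragg transform $\mathfrak{B}$ with weighting $W$ is injective on $L^2_0(\mathfrak{E}\times\mathbb{R}\times\mathcal{I})$.
   Context: Notation: $\mathbb{R}_+=(0,\infty)$, $\mathcal{I}=(-1,1)$, and $\mathfrak{E}=[E_m,E_M]$ with $0<E_m<E_M$ fixed. $L^2_0(\Omega)$ is the set of (real-valued) $L^2$ functions with compact support on $\Omega$; $f\in L^2_0(\mathfrak{E}\times\mathbb{R}\times\mathcal{I})$ is extended by zero to values of its first variable $q$ outside $\mathfrak{E}$. $\chi_S$ is the characteristic function of a set $S$. ''Non-vanishing'' means nowhere zero. Fix $\beta\in(0,\pi)$ and set $w(x_2)=(1+x_2)\tan\frac{\beta}{2}$ for $x_2\in\mathcal{I}$. Fix a diffeomorphism $\Phi:\mathcal{I}\to\Phi(\mathcal{I})\subset\mathbb{R}$ with $0\le\Phi(x_2)\le M$ for all $x_2\in\mathcal{I}$, for some $M>0$. For $x_2\in\mathcal{I}$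 define $$q_1(x_1)=q_1(x_1;x_2)=\frac{1}{\sqrt2}\sqrt{1+\frac{x_1^2-(1-x_2^2)}{\sqrt{x_1^2+(x_2+1)^2}\,\sqrt{x_1^2+(1-x_2)^2}}},\qquad x_1\in\mathbb{R}.$$ The Bragg transform (with weighting $W$), regarded as a linear map $\mathfrak{B}:L^2_0(\mathfrak{E}\times\mathbb{R}\times\mathcal{I})\to L^2(\mathbb{R}_+\times\mathbb{R}\times\Phi(\mathcal{I}))$, is $$\mathfrak{B}f(E,s_1,\Phi(x_2))=\int_{\mathbb{R}}\chi_{[-w(x_2),w(x_2)]}(x_1-s_1)\,W(E,x_1-s_1,x_2)\,f(Eq_1(x_1-s_1),x_1,x_2)\,\mathrm{d}x_1,$$ for $E\in\mathbb{R}_+$, $s_1\in\mathbb{R}$, $x_2\in\mathcal{I}$. Injectivity means: if $\mathfrak{B}f=0$ almost everywhere then $f=0$ almost everywhere. *)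

(* Defs.v *)
From HB Require Import structures.
From mathcomp Require Import all_boot all_order all_algebra.
From mathcomp Require Import all_classical all_reals all_analysis.

Set Implicit Arguments.
Unset Strict Implicit.
Unset Printing Implicit Defensive.

Import Order.TTheory GRing.Theory Num.Theory.
Import numFieldNormedType.Exports.

Local Open Scope classical_set_scope.
Local Open Scope ring_scope.

(* Meant for open A: the differential exists at every point of A and depends
   continuously on it.  Only the values of f on A matter. *)
Definition C1_on (R : realType) (V : normedModType R) (A : set V)
    (f : V -> R) : Prop :=
  {in A, forall x, differentiable f x} /\
  forall v : V, {in A, continuous (fun x => 'D_v f x)}.

(* For f continuous and injective on an open interval A, f @` A is open, so the
   default values of the partial inverse outside f @` A are irrelevant. *)
Definition diffeo_onto_image (R : realType) (A : set R) (f : R -> R) : Prop :=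
  [/\ C1_on A f, {in A &, injective f}
    & C1_on (f @` A) ('pinv_(fun=> 0) A f)].

Definition leb3 (R : realType) :=
  ((@lebesgue_measure R \x @lebesgue_measure R) \x @lebesgue_measure R)%E.

(* Representatives of the classes in L^2(D) with compact (essential) support
   contained in D; the values of f outside D are irrelevant, and f \_ D is its
   extension by zero. *)
Definition L2_0 (R : realType) (D : set (R * R * R)) (f : R * R * R -> R)
    : Prop :=
  f \_ D \in Lfun (@leb3 R) 2%:E /\
  exists K : set (R * R * R),
    [/\ compact K, K `<=` D
      & {ae @leb3 R, forall z, D z -> ~ K z -> f z = 0}].

Section Bragg.
Variable R : realType.

Definition Iset : set R := `]-1, 1[.

Definition Rpos : set R := `]0, +oo[.

Definition energy_domain (Em EM : R) : set (R * R * R) :=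
  (`[Em, EM] `*` setT) `*` Iset.

Definition width (beta x2 : R) : R := (1 + x2) * tan (beta / 2).

Definition q1 (x1 x2 : R) : R :=
  (Num.sqrt 2)^-1 *
  Num.sqrt (1 + (x1 ^+ 2 - (1 - x2 ^+ 2)) /
                (Num.sqrt (x1 ^+ 2 + (x2 + 1) ^+ 2) *
                 Num.sqrt (x1 ^+ 2 + (1 - x2) ^+ 2))).

(* The value of the transform at (E, s1, Phi x2). *)
Definition bragg_fiber (Em EM beta : R) (W : R -> R -> R -> R)
    (f : R * R * R -> R) (E s1 x2 : R) : R :=
  \int[@lebesgue_measure R]_x1
    (\1_(`[- width beta x2, width beta x2]%classic) (x1 - s1) *
     W E (x1 - s1) x2 *
     (f \_ (energy_domain Em EM)) (E * q1 (x1 - s1) x2, x1, x2)).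

Definition bragg (Em EM beta : R) (Phi : R -> R) (W : R -> R -> R -> R)
    (f : R * R * R -> R) (z : R * R * R) : R :=
  bragg_fiber Em EM beta W f z.1.1 z.1.2 ('pinv_(fun=> 0) Iset Phi z.2).

Definition bragg_injective (Em EM beta : R) (Phi : R -> R)
    (W : R -> R -> R -> R) : Prop :=
  forall f : R * R * R -> R,
    L2_0 (energy_domain Em EM) f ->
    {ae @leb3 R, forall z, ((Rpos `*` setT) `*` (Phi @` Iset)) z ->
       bragg Em EM beta Phi W f z = 0} ->
    {ae @leb3 R, forall z, energy_domain Em EM z -> f z = 0}.

End Bragg.

(* Main.v *)
Require Import Defs.
From HB Require Import structures.
From mathcomp Require Import all_boot all_order all_algebra.
From mathcomp Require Import all_classical all_reals all_analysis.
From mathcomp Require Import measurable_realfun ring lra.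

Set Implicit Arguments.
Unset Strict Implicit.
Unset Printing Implicit Defensive.

Import Order.TTheory GRing.Theory Num.Theory.
Import numFieldNormedType.Exports.

Local Open Scope classical_set_scope.
Local Open Scope ring_scope.

(* Fix x2 and write Q = q1(., x2).  Multiplying the vanishing transform by
   E^-(n+2) exp(m s) and integrating over E, s and t = x1 - s, the substitution
   q = E Q(t), x = s + t separates the variables: up to the nonvanishing W1,
     0 = (int_{-w}^w W2(t, x2) exp(-m t) Q(t)^(n+1) dt)
         * (int int f(q, x, x2) q^-(n+2) exp(m x) dq dx).
   The continuous function W2(., x2) has no zero, hence a constant sign, and the
   other factors of the first integrand are positive for t != 0; so the second
   integral, a joint moment of f(., ., x2) in 1/q and exp x, vanishes for all
   m, n.  Since (1/q, exp x) is bounded on the support of f and injective, these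
   moments determine f: if int G h^k = 0 for all k, expanding the exponential
   gives int G exp(-b (h/c)^N) = 0, whose limit for N -> oo is
   int G 1_{h < c} + exp(-b) int G 1_{h = c}, for every b > 0.  Null sets of
   Phi(x2) pull back to null sets of x2 because the inverse of Phi is
   differentiable. *)

(** * Affine changes of variables on the line and in the plane *)

Section affine.
Local Open Scope ereal_scope.
Variable R : realType.
Local Notation mu := (@lebesgue_measure R).

Let affine (a b : R) : measurableTypeR R -> measurableTypeR R :=
  fun x => (a * x + b)%R.

Let measurable_affine (a b : R) : measurable_fun setT (affine a b).
Proof. by apply: measurable_funD => //; exact: measurable_funM. Qed.

Let pushforward_affine (a b : R) : {measure set (measurableTypeR R) -> \bar R} :=
  measure_function_pushforward__canonical__measure_function_Measure mu
    (measurable_affine a b).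

(** By uniqueness of Lebesgue measure it is enough to test half-open intervals []u, v]], whose
    preimage has length (v - u) / a. *)
Let lebesgue_measure_affine (a b : R) (a0 : (0 < a)%R) A : measurable A ->
  mu A = mscale (NngNum (ltW a0)) (pushforward_affine a b) A.
Proof.
move=> mA; apply: lebesgue_measure_unique => //= _ [[u v]] _ <-.
rewrite /mscale/= /pushforward/=.
rewrite [in RHS](_ : _ @^-1` _ = `]((u - b) / a)%R, ((v - b) / a)%R]%classic); last first.
  apply/seteqP; split => x /=; rewrite !in_itv/= /affine;
    by rewrite ltr_pdivrMr// ler_pdivlMr// (mulrC x) ltrBlDr lerBrDr.
rewrite !lebesgue_measure_itv/= !lte_fin ltr_pM2r ?invr_gt0// ltrBlDr subrK.
case: ifPn => _; last by rewrite mule0.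
by rewrite -!EFinD -EFinM; congr EFin; field; rewrite gt_eqF.
Qed.

Lemma ge0_integral_affine (a b : R) (f : R -> \bar R) : (0 < a)%R ->
  measurable_fun [set: R] f -> (forall x, 0 <= f x) ->
  \int[mu]_x f x = a%:E * \int[mu]_x f (a * x + b)%R.
Proof.
move=> a0 mf f0.
rewrite (eq_measure_integral (mscale (NngNum (ltW a0)) (pushforward_affine a b))).
  by rewrite ge0_integral_mscale//= ge0_integral_pushforward.
by move=> A mA _; exact: lebesgue_measure_affine.
Qed.

(** Measurability is enough: no constant has to be distributed over the difference of the positive
    and negative parts, so that difference may be undefined. *)
Lemma integral_translation (b : R) (f : R -> \bar R) :
  measurable_fun [set: R] f -> \int[mu]_x f x = \int[mu]_x f (x + b)%R.
Proof.
move=> mf; rewrite integralE [RHS]integralE.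
rewrite (@ge0_integral_affine 1 b)//; last exact: measurable_funepos.
rewrite (@ge0_integral_affine 1 b f^\-)//; last exact: measurable_funeneg.
rewrite !mul1e; congr (_ - _); apply: eq_integral => x _.
  by rewrite mul1r !funeposE.
by rewrite mul1r !funenegE.
Qed.

(** This is the substitution q = a E, x = s + t at fixed t. Tonelli lets the two variables be
    changed one at a time. *)
Lemma ge0_integral_affine2 (a t : R) (f : R * R -> \bar R) : (0 < a)%R ->
  measurable_fun [set: R * R] f -> (forall x, 0 <= f x) ->
  \int[mu \x mu]_z f (a * z.1, z.2 + t)%R = a^-1%:E * \int[mu \x mu]_z f z.
Proof.
move=> a0 mf f0.
have mg : measurable_fun setT (fun z : R * R => f (a * z.1, z.2 + t)%R).
  apply: measurableT_comp => //; apply/measurable_fun_pairP; split.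
    exact: measurable_funM.
  exact: measurable_funD.
rewrite fubini_tonelli1// [in RHS]fubini_tonelli1//.
rewrite (@ge0_integral_affine a 0 (fubini_F mu f))//; last 2 first.
- exact: measurable_fun_fubini_tonelli_F.
- by move=> x; exact: integral_ge0.
rewrite muleA -EFinM mulVf ?gt_eqF// mul1e; apply: eq_integral => x _.
rewrite /fubini_F/= addr0 [RHS](integral_translation t)//.
exact: measurableT_comp.
Qed.

Lemma integrable_affine2 (a t : R) (f : R * R -> \bar R) : (0 < a)%R ->
  (mu \x mu).-integrable setT f ->
  (mu \x mu).-integrable setT (fun z => f (a * z.1, z.2 + t)%R).
Proof.
move=> a0 /integrableP[mf fi]; apply/integrableP; split.
  apply: (measurableT_comp mf); apply/measurable_fun_pairP; split.
    exact: measurable_funM.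
  exact: measurable_funD.
have mabs : measurable_fun [set: R * R] (abse \o f) by exact: measurableT_comp.
rewrite (@ge0_integral_affine2 a t (abse \o f))//; last by move=> x /=.
by rewrite lte_mul_pinfty// lee_fin invr_ge0 ltW.
Qed.

Lemma integral_affine2 (a t : R) (f : R * R -> \bar R) : (0 < a)%R ->
  (mu \x mu).-integrable setT f ->
  \int[mu \x mu]_z f (a * z.1, z.2 + t)%R = a^-1%:E * \int[mu \x mu]_z f z.
Proof.
move=> a0 intf; have mf := measurable_int _ intf.
rewrite integralE [in RHS]integralE muleBr//; last first.
  by apply: integrable_add_def.
rewrite -(@ge0_integral_affine2 a t f^\+)//; last exact: measurable_funepos.
rewrite -(@ge0_integral_affine2 a t f^\-)//; last exact: measurable_funeneg.
by congr (_ - _); apply: eq_integral => x _; rewrite ?funeposE ?funenegE.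
Qed.

End affine.

(** * Lebesgue measure on the plane as a sigma-finite measure *)

Section plane.
Variable R : realType.
Local Notation mu := (@lebesgue_measure R).
Local Open Scope ereal_scope.

(* The library does not infer that a product of sigma-finite measures is
   sigma-finite: an instance for products of subprobabilities comes first. *)
Definition leb2 : set (measurableTypeR R * measurableTypeR R)%type -> \bar R := mu \x mu.

HB.instance Definition _ := Measure.on leb2.

(** Squares of an increasing exhaustion of the line cover the plane, since monotonicity puts both
    coordinates into a common member. *)
Lemma leb2_sigma_finite : sigma_finite setT leb2.
Proof.
have /sigma_finiteP[F [TF ndF Foo]] := @sigma_finiteT _ _ _ mu.
exists (fun n => F n `*` F n).
  rewrite -setXTT TF; apply/seteqP; split.
  move=> [x y] [[m _ Fx] [n _ Fy]].
  exists (maxn m n) => //; split.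
    exact: (elimT (subsetPset _ _) (ndF _ _ (leq_maxl m n))) Fx.
  exact: (elimT (subsetPset _ _) (ndF _ _ (leq_maxr m n))) Fy.
  by move=> [x y] [n _ [Fx Fy]]; split; exists n.
move=> n; have [mF Fn] := Foo n; split; first exact: measurableX.
by rewrite /leb2 product_measure1E// lte_mul_pinfty// ge0_fin_numE.
Qed.

HB.instance Definition _ := Measure_isSigmaFinite.Build _ _ _ leb2 leb2_sigma_finite.
End plane.

(** * Bounds and limits of exponentials for dominated convergence *)

Lemma expR_partial_le (R : realType) (x : R) n :
  `|series (exp_coeff x) n| <= expR `|x|.
Proof.
apply: (@le_trans _ _ (series (exp_coeff `|x|) n)).
  rewrite /series/= (le_trans (ler_norm_sum _ _ _))//.
  by apply: ler_sum => i _; rewrite /exp_coeff/= normrM normrX normfV normr_nat.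
apply: nondecreasing_cvgn_le; last exact: is_cvg_series_exp_coeff.
apply: nondecreasing_series => i _ _.
by apply: exp_coeff_ge0.
Qed.

(** The exponent b r^n tends to 0, stays at b or tends to infinity according to the position of r
    relative to 1. The limit is thus a sharp cutoff with an intermediate value at r = 1. *)
Lemma cvg_gompertz (R : realType) (b r : R) : 0 < b -> 0 <= r ->
  expR (- (b * r ^+ n)) @[n --> \oo] -->
    (r < 1)%R%:R + expR (- b) * (r == 1)%R%:R.
Proof.
move=> b0 r0; have [r1|r1|->] := ltgtP r 1.
- rewrite mulr0 addr0 -[X in _ --> X]expR0.
  apply: continuous_cvg; first exact: continuous_expR.
  rewrite -oppr0; apply: cvgN; rewrite -(mulr0 b); apply: cvgMr.
  by apply: cvg_expr; rewrite ger0_norm.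
- rewrite mulr0 addr0.
  (* For r > 1, the bound exp(-y) <= 1 / y gives a geometric majorant. *)
  have rV : b^-1 * r^-1 ^+ n @[n --> \oo] --> (0 : R).
    rewrite -(mulr0 b^-1); apply: cvgMr; apply: cvg_expr.
    by rewrite ger0_norm ?invr_ge0// invf_lt1// (lt_trans _ r1).
  apply: (squeeze_cvgr _ (cvg_cst 0) rV); near=> n.
  rewrite expR_ge0/= expRN exprVn -invfM.
  have r_gt0 : 0 < b * r ^+ n by rewrite mulr_gt0// exprn_gt0// (lt_trans _ r1).
  rewrite lef_pV2 ?posrE ?expR_gt0//.
  by rewrite mulrC (le_trans _ (expR_ge1Dx _))// mulrC lerDr.
- rewrite add0r mulr1.
  under eq_fun do rewrite expr1n mulr1.
  exact: cvg_cst.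
Unshelve. all: by end_near.
Qed.

(** * Moments of one bounded function *)

Section moments.
Context d (T : measurableType d) (R : realType).
Variable mu : {measure set T -> \bar R}.
Local Open Scope ereal_scope.

Lemma integrable_bounded_mul (G h : T -> R) (M : R) :
  mu.-integrable setT (EFin \o G) -> measurable_fun setT h ->
  (forall x, `|h x| <= M)%R ->
  mu.-integrable setT (fun x => (G x * h x)%:E).
Proof.
move=> iG mh hM.
apply: (@integrableMl _ _ _ mu setT measurableT (EFin \o G) h iG mh).
exists M; split; first exact: num_real.
by move=> y My x _ /=; rewrite (le_trans (hM x))// ltW.
Qed.

(** Dominated convergence with majorant M |G|; the limit passages of the moment argument all go
    through this lemma. *)
Lemma integral_bounded_cvg_eq0 (G h : T -> R) (h_ : nat -> T -> R) (M : R) :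
  mu.-integrable setT (EFin \o G) ->
  (forall n, measurable_fun setT (h_ n)) -> measurable_fun setT h ->
  (forall n x, `|h_ n x| <= M)%R ->
  (forall x, h_ n x @[n --> \oo] --> h x) ->
  (forall n, \int[mu]_x (G x * h_ n x)%:E = 0) ->
  \int[mu]_x (G x * h x)%:E = 0.
Proof.
move=> iG mh_ mh h_M h_h h_0.
have mG : measurable_fun setT G.
  by apply/measurable_EFinP; exact: measurable_int iG.
pose f_ n x := (G x * h_ n x)%:E.
have [] := @dominated_convergence _ _ _ mu setT measurableT f_
  (fun x => (G x * h x)%:E) (fun x => M%:E * `|(G x)%:E|).
- by move=> n; apply/measurable_EFinP; exact: measurable_funM.
- by apply/measurable_EFinP; exact: measurable_funM.
- apply: aeW => x _; apply: cvg_EFin; first exact: nearW.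
  exact: cvgMr.
- by apply: integrableZl => //; exact: integrable_abse.
- apply: aeW => x n _; rewrite /f_ -EFinM lee_fin normrM mulrC.
  by rewrite ler_wpM2r// h_M.
- move=> _ _ cv; apply: (cvg_unique _ cv) => //.
  by rewrite (_ : [sequence _]_n = cst 0)//; [exact: cvg_cst|apply/funext => n; exact: h_0].
Qed.

(** The partial sums of the exponential series are polynomials in [h], so they integrate to zero
    against [G], and exp M bounds them all. *)
Lemma integral_moments_expR (G h : T -> R) (M : R) :
  mu.-integrable setT (EFin \o G) -> measurable_fun setT h ->
  (forall x, `|h x| <= M)%R ->
  (forall k, \int[mu]_x (G x * h x ^+ k)%:E = 0) ->
  \int[mu]_x (G x * expR (h x))%:E = 0.
Proof.
move=> iG mh hM mom.
apply: (@integral_bounded_cvg_eq0 _ _ (fun n x => series (exp_coeff (h x)) n) (expR M)) => //.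
- move=> n; rewrite /series/=; apply: measurable_sum => i.
  rewrite /exp_coeff/=; apply: measurable_funM => //; exact: measurable_funX.
- by apply: measurableT_comp.
- by move=> n x; rewrite (le_trans (expR_partial_le _ _))// ler_expR.
- by move=> x; exact: is_cvg_series_exp_coeff.
- move=> n.
  under eq_integral do rewrite /series/= mulr_sumr -sumEFin.
  rewrite integral_sum//.
    rewrite big1// => i _.
    under eq_integral do rewrite /exp_coeff/= mulrA mulrC EFinM.
    rewrite integralZl// ?mom ?mule0//.
    apply: integrable_bounded_mul; [done|exact: measurable_funX|].
    by move=> x; rewrite normrX; apply: lerXn2r (hM x); rewrite ?nnegrE// (le_trans _ (hM x)).
  move=> i; apply: (@integrable_bounded_mul _ _ (M ^+ i / i`!%:R)) => //.
    rewrite /exp_coeff/=; apply: measurable_funM => //; exact: measurable_funX.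
  move=> x; rewrite /exp_coeff/= normrM normrX normfV normr_nat ler_wpM2r//.
  by apply: lerXn2r (hM x); rewrite ?nnegrE// (le_trans _ (hM x)).
Qed.

(** The function exp(-b (h/c)^n) approximates a cutoff at level c while being a power series in [h],
    so the moments control it. The level set h = c may carry mass; the free parameter b separates
    its contribution. *)
Lemma integral_moments_lt (G h : T -> R) (M c : R) :
  mu.-integrable setT (EFin \o G) -> measurable_fun setT h ->
  (forall x, 0 <= h x <= M)%R ->
  (forall k, \int[mu]_x (G x * h x ^+ k)%:E = 0) -> (0 < c)%R ->
  \int[mu]_x (G x * (h x < c)%R%:R)%:E = 0.
Proof.
move=> iG mh hM mom c0.
have mlt : measurable_fun setT (fun x => (h x < c)%R%:R : R).
  by apply: measurableT_comp => //; exact: measurable_fun_ltr.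
have meq : measurable_fun setT (fun x => (h x == c)%R%:R : R).
  by apply: measurableT_comp => //; exact: measurable_fun_eqr.
have gomp b : (0 < b)%R ->
    \int[mu]_x (G x * (h x < c)%R%:R)%:E +
    (expR (- b))%:E * \int[mu]_x (G x * (h x == c)%R%:R)%:E = 0.
  move=> b0; rewrite -integralZl//; last first.
    by apply: (@integrable_bounded_mul _ _ 1) => // x; rewrite normr_nat lern1 leq_b1.
  rewrite -integralD//; last 2 first.
  - by apply: (@integrable_bounded_mul _ _ 1) => // x; rewrite normr_nat lern1 leq_b1.
  - apply: integrableZl => //.
    by apply: (@integrable_bounded_mul _ _ 1) => // x; rewrite normr_nat lern1 leq_b1.
  transitivity (\int[mu]_x (G x * ((h x / c < 1)%R%:R + expR (- b) * (h x / c == 1)%R%:R))%:E).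
    apply: eq_integral => x _; rewrite -EFinM -EFinD ltr_pdivrMr// mul1r.
    rewrite (can2_eq (divfK (lt0r_neq0 c0)) (mulfK (lt0r_neq0 c0))) mul1r.
    by congr EFin; ring.
  have mr : measurable_fun setT (fun x => (h x / c)%R) by exact: measurable_funM.
  apply: (@integral_bounded_cvg_eq0 _ _ (fun n x => expR (- (b * (h x / c) ^+ n))) 1) => //.
  - move=> n; apply: measurableT_comp => //; apply: measurableT_comp => //.
    by apply: measurable_funM => //; exact: measurable_funX.
  - apply: measurable_funD.
      by apply: measurableT_comp => //; exact: measurable_fun_ltr.
    apply: measurable_funM => //.
    by apply: measurableT_comp => //; exact: measurable_fun_eqr.
  - move=> n x; have /andP[hx0 _] := hM x.
    rewrite ger0_norm ?expR_ge0// expR_le1 oppr_le0 mulr_ge0 ?(ltW b0)//.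
    by rewrite exprn_ge0// divr_ge0// ltW.
  - move=> x; have /andP[hx0 _] := hM x; apply: cvg_gompertz => //.
    by rewrite divr_ge0// ltW.
  - move=> n; apply: (@integral_moments_expR _ _ (b * (M / c) ^+ n)) => //.
    + apply: measurableT_comp => //.
      by apply: measurable_funM => //; exact: measurable_funX.
    + move=> x; have /andP[hx0 hxM] := hM x.
      rewrite normrN normrM (ger0_norm (ltW b0)) ler_wpM2l ?(ltW b0)//.
      rewrite ger0_norm ?exprn_ge0 ?divr_ge0 ?(ltW c0)//.
      have M0 := le_trans hx0 hxM.
      by rewrite lerXn2r ?nnegrE ?divr_ge0 ?(ltW c0)// ler_pM2r ?invr_gt0.
    (* The k-th power of -b (h/c)^n is a constant times h^(n k), again a vanishing moment. *)
    + move=> k; rewrite (eq_integral (fun x => ((- b * c ^- n) ^+ k)%:E * (G x * h x ^+ (n * k))%:E)).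
        rewrite integralZl ?mom ?mule0//.
        apply: (@integrable_bounded_mul _ _ (M ^+ (n * k))) => //.
          exact: measurable_funX.
        move=> x; have /andP[hx0 hxM] := hM x.
        by rewrite ger0_norm ?exprn_ge0// lerXn2r ?nnegrE ?(le_trans hx0).
      move=> x _; rewrite -EFinM; congr EFin.
      by rewrite -mulNr !exprMn exprVn -exprVn !exprM; ring.
(* The values of [b] at 1 and 2 separate the two integrals. *)
have := gomp 1%R ltr01; have := gomp 2%R (ltr0n _ 2).
set A := \int[mu]_x _; set B := \int[mu]_x _.
have Af : A \is a fin_num.
  apply: integrable_fin_num => //.
  by apply: (@integrable_bounded_mul _ _ 1) => // x; rewrite normr_nat lern1 leq_b1.
have Bf : B \is a fin_num.
  apply: integrable_fin_num => //.
  by apply: (@integrable_bounded_mul _ _ 1) => // x; rewrite normr_nat lern1 leq_b1.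
rewrite -(fineK Af) -(fineK Bf) -!EFinM -!EFinD => -[e2] [e1]; congr EFin.
have : (fine B * (expR (- 1) - expR (- 2)) = 0)%R.
  by rewrite mulrBr; move: e1 e2; lra.
move/eqP; rewrite mulf_eq0 subr_eq0 => /orP[/eqP B0|/eqP /expR_inj]; last lra.
by move: e1; rewrite B0 mulr0 addr0.
Qed.

(** The sets on which the signed measure with density [G], pushed forward by [h], vanishes form a
    Dynkin class: complements use the zero total integral, disjoint unions the integrability of
    [G]. *)
Lemma integral_dynkin d' (T' : measurableType d') (S : set (set T'))
    (G : T -> R) (h : T -> T') :
  @measurable _ T' = <<s S >> -> setI_closed S ->
  mu.-integrable setT (EFin \o G) -> measurable_fun setT h ->
  \int[mu]_x (G x)%:E = 0 ->
  (forall A, S A -> \int[mu]_(x in h @^-1` A) (G x)%:E = 0) ->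
  forall A, measurable A -> \int[mu]_(x in h @^-1` A) (G x)%:E = 0.
Proof.
move=> mS SI iG mh G0 SG A mA.
have mpre B : measurable B -> measurable (h @^-1` B).
  by move=> mB; rewrite -[_ @^-1` _]setTI; exact: mh.
have mG : measurable_fun setT (EFin \o G) by exact: measurable_int iG.
apply: (@dynkin_induction _ T' S
  (fun A => \int[mu]_(x in h @^-1` A) (G x)%:E = 0)) => //; last by rewrite -mS.
- move=> B mB B0; have : \int[mu]_(x in h @^-1` B `|` h @^-1` (~` B)) (G x)%:E = 0.
    by rewrite -preimage_setU setUCr preimage_setT.
  rewrite integral_setU//; last 4 first.
  - exact: mpre.
  - by apply: mpre; exact: measurableC.
  - exact: measurable_funTS.
  - by apply/disj_setPS => x [].
  by rewrite B0 add0e.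
- move=> F mF tF F0; rewrite preimage_bigcup integral_bigcup//.
  + by rewrite eseries0// => n _ _; exact: F0.
  + apply/trivIsetP => i j _ _ ij; rewrite -preimage_setI.
    by move/trivIsetP : tF => /(_ _ _ _ _ ij) ->//; rewrite preimage_set0.
  + by move=> k; exact: mpre.
  + by apply: integrableS iG => //; apply: bigcup_measurable => k _; exact: mpre.
Qed.

End moments.

(** * From vanishing moments to vanishing integrals over preimages *)

Section moments2.
Context d (T : measurableType d) (R : realType).
Variable mu : {measure set T -> \bar R}.
Local Open Scope ereal_scope.

Lemma integral_indicM (G : T -> R) (A : set T) :
  \int[mu]_(x in A) (G x)%:E = \int[mu]_x (G x * \1_A x)%:E.
Proof. by rewrite integral_mkcond; apply: eq_integral => x _; rewrite epatch_indic. Qed.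

(** The rays []-oo, c[] form a generating pi-system. For c > 0 the cutoff lemma applies, for c <= 0
    the preimage is empty because h >= 0, and the total integral is the moment of order 0. *)
Lemma integral_moments_preimage (G h : T -> R) (M : R) :
  mu.-integrable setT (EFin \o G) -> measurable_fun setT h ->
  (forall x, 0 <= h x <= M)%R ->
  (forall k, \int[mu]_x (G x * h x ^+ k)%:E = 0) ->
  forall B, measurable B -> \int[mu]_(x in h @^-1` B) (G x)%:E = 0.
Proof.
move=> iG mh hM mom; apply: (integral_dynkin (S := @RGenInftyO.G R)) => //.
- exact: RGenInftyO.measurableE.
- move=> _ _ [x ->] [y ->]; exists (Num.min x y).
  by apply/seteqP; split => z /=; rewrite !in_itv/= lt_min => /andP.
- have := mom 0%N; under eq_integral do rewrite expr0 mulr1.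
  by [].
- move=> _ [c ->]; have [c0|c0] := ltP 0%R c.
    rewrite integral_indicM -[RHS](integral_moments_lt iG mh hM mom c0).
    apply: eq_integral => x _; rewrite indicE; congr (_ * (nat_of_bool _)%:R)%:E.
    by apply/idP/idP; rewrite inE/= in_itv.
  rewrite (_ : _ @^-1` _ = set0) ?integral_set0//.
  apply/seteqP; split => x //=; rewrite in_itv/= => hc.
  by have /andP[] := hM x; lra.
Qed.

(** The one-function result is used twice. For fixed l, the density G v^l has vanishing moments in
    [u], hence zero integral over the preimage of [A]; this says that [G] restricted to that
    preimage has vanishing moments in [v]. *)
Lemma integral_moments2_preimage (G u v : T -> R) (M N : R) :
  mu.-integrable setT (EFin \o G) ->
  measurable_fun setT u -> measurable_fun setT v ->
  (forall x, 0 <= u x <= M)%R -> (forall x, 0 <= v x <= N)%R ->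
  (forall k l, \int[mu]_x (G x * v x ^+ l * u x ^+ k)%:E = 0) ->
  forall A B, measurable A -> measurable B ->
  \int[mu]_(x in u @^-1` A `&` v @^-1` B) (G x)%:E = 0.
Proof.
move=> iG mu' mv uM vN mom A B mA mB.
have mpre C : measurable C -> measurable (u @^-1` C).
  by move=> mC; rewrite -[_ @^-1` _]setTI; exact: mu'.
have iGv l : mu.-integrable setT (fun x => (G x * v x ^+ l)%:E).
  apply: (@integrable_bounded_mul _ _ _ _ _ _ (N ^+ l)) => //; first exact: measurable_funX.
  move=> x; have /andP[v0 vN'] := vN x; have N0 := le_trans v0 vN'.
  by rewrite ger0_norm ?exprn_ge0// lerXn2r ?nnegrE.
rewrite setIC integral_mkcondr.
have iGA : mu.-integrable setT (fun x => (G x * \1_(u @^-1` A) x)%:E).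
  apply: (@integrable_bounded_mul _ _ _ _ _ _ 1) => //.
    by apply: measurable_indic; exact: mpre.
  by move=> x; rewrite indicE normr_nat lern1 leq_b1.
rewrite -[RHS](integral_moments_preimage (G := fun x => (G x * \1_(u @^-1` A) x)%R) iGA mv vN _ mB).
  by apply: eq_integral => x _; rewrite epatch_indic.
move=> l; rewrite -[RHS](integral_moments_preimage (iGv l) mu' uM (mom ^~ l) mA).
by rewrite integral_indicM; apply: eq_integral => x _; congr EFin; ring.
Qed.

End moments2.

(** * Determinacy of the joint moments in 1/q and exp x *)

Section determinacy.
Variable R : realType.
Local Notation mu := (@lebesgue_measure R).
Local Open Scope ereal_scope.

Lemma ae_eq0_moments (g : R * R -> R) (a b c : R) : (0 < a)%R ->
  (mu \x mu).-integrable setT (EFin \o g) ->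
  (forall z, ~ (a <= z.1 <= b /\ `|z.2| <= c)%R -> g z = 0%R) ->
  (forall k l, \int[mu \x mu]_z (g z * expR z.2 ^+ l * z.1 ^- k)%:E = 0) ->
  {ae mu \x mu, forall z, g z = 0%R}.
Proof.
move=> a0 ig gbox mom.
pose box : set (R * R) := `[a, b] `*` `[(- c)%R, c].
have mbox : measurable box by apply: measurableX.
have boxP z : ~ box z -> g z = 0%R.
  move=> nz; apply: gbox => -[ab zc]; apply: nz; split => /=; rewrite in_itv//=.
  by rewrite -ler_norml.
(* The cutoff makes [u] and [v] bounded on the whole plane; on the box, where z.1 > 0, they are 1/q
   and exp x. *)
pose u z : R := (\1_box z * expR (- ln z.1))%R.
pose v z : R := (\1_box z * expR z.2)%R.
have mu' : measurable_fun setT u.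
  apply: measurable_funM; first exact: measurable_indic.
  apply: measurableT_comp => //; apply: measurableT_comp => //.
  by apply: measurableT_comp => //; exact: measurable_ln.
have mv : measurable_fun setT v.
  apply: measurable_funM; first exact: measurable_indic.
  exact: measurableT_comp.
have uE z : box z -> u z = (z.1^-1)%R.
  move=> bz; rewrite /u indicE mem_set// mul1r expRN lnK// posrE.
  by move: bz => [/= + _]; rewrite in_itv/= => /andP[+ _]; exact: lt_le_trans.
have vE z : box z -> v z = expR z.2.
  by move=> bz; rewrite /v indicE mem_set// mul1r.
have u0 z : ~ box z -> u z = 0%R.
  by move=> bz; rewrite /u indicE memNset// mul0r.
have v0 z : ~ box z -> v z = 0%R.
  by move=> bz; rewrite /v indicE memNset// mul0r.
have uM z : (0 <= u z <= a^-1)%R.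
  have [bz|bz] := pselect (box z); last by rewrite u0// lexx invr_ge0 ltW.
  rewrite uE//; move: bz => [/= + _]; rewrite in_itv/= => /andP[az _].
  by rewrite invr_ge0 (le_trans (ltW a0))//= lef_pV2 ?posrE// (lt_le_trans a0).
have vM z : (0 <= v z <= expR c)%R.
  have [bz|bz] := pselect (box z); last by rewrite v0// lexx expR_ge0.
  rewrite vE//; move: bz => [/= _]; rewrite in_itv/= => /andP[_ zc].
  by rewrite expR_ge0/= ler_expR.
have momuv k l : \int[mu \x mu]_z (g z * v z ^+ l * u z ^+ k)%:E = 0.
  rewrite -[RHS](mom k l); apply: eq_integral => z _.
  have [bz|bz] := pselect (box z); first by rewrite uE// vE// exprVn.
  by rewrite boxP// !mul0r.
have rect (A B : set R) : measurable A -> measurable B ->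
    \int[mu \x mu]_(z in A `*` B) (g z)%:E = 0.
  move=> mA mB.
  (* On the box, [A'] and [B'] undo [u] and [v]: the rectangle is the common preimage of [A'] under
     [u] and [B'] under [v]. *)
  pose A' : set R := (fun y => expR (- ln y)) @^-1` A.
  pose B' : set R := @ln R @^-1` B.
  have mexpNln : measurable_fun [set: R] (fun y : R => expR (- ln y)).
    apply: measurableT_comp; first exact: measurable_expR.
    by apply: measurableT_comp => //; exact: measurable_ln.
  have mA' : measurable A' by rewrite -[A']setTI; exact: mexpNln.
  have mB' : measurable B' by rewrite -[B']setTI; exact: measurable_ln.
  rewrite -[RHS](integral_moments2_preimage ig mu' mv uM vM momuv mA' mB').
  rewrite [LHS]integral_indicM [RHS]integral_indicM; apply: eq_integral => z _.
  have [bz|bz] := pselect (box z); last by rewrite boxP// !mul0r.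
  congr (_ * _)%:E; rewrite !indicE; congr (nat_of_bool _)%:R.
  have z0 : (0 < z.1)%R.
    by move: bz => [/= + _]; rewrite in_itv/= => /andP[+ _]; exact: lt_le_trans.
  apply/idP/idP; rewrite !inE/= /A' /B'/= uE// vE// expRK;
    by rewrite lnV ?posrE// opprK lnK ?posrE.
(* Rectangles are a pi-system generating the product sigma-algebra. *)
have gA A : measurable A -> \int[mu \x mu]_(z in A) (g z)%:E = 0.
  move=> mA; rewrite -[A]preimage_id.
  apply: (integral_dynkin (S := [set A `*` B | A in @measurable _ R & B in @measurable _ R])) => //.
  - exact: measurable_prod_measurableType.
  - move=> _ _ [A1 mA1 [B1 mB1 <-]] [A2 mA2 [B2 mB2 <-]].
    exists (A1 `&` A2); first exact: measurableI.
    exists (B1 `&` B2); first exact: measurableI.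
    by rewrite setXI.
  - by rewrite -setXTT; exact: rect.
  - by move=> _ [A1 mA1 [B1 mB1 <-]]; rewrite preimage_id; exact: rect.
have : ae_eq (mu \x mu) setT (EFin \o g) (cst 0).
  apply: integral_ae_eq => // E _ mE.
  by rewrite gA// integral_cst// mul0e.
by apply: filterS => z /= /(_ I) [].
Qed.

End determinacy.

(** * Separation of variables by Fubini *)

Section convolution.
Variable R : realType.
Local Notation mu := (@lebesgue_measure R).
Local Notation mu2 := (@leb2 R).
Local Open Scope ereal_scope.

(** The function P(t) K(Q(t) E, s + t) is integrated in both orders: over (E, s) first, the affine
    substitution yields the product; over t first, the inner integral vanishes almost everywhere.
    The vanishing is asked only where the t-section is integrable, which Fubini grants almost
    everywhere and which lets constants be pulled out when the lemma is applied. *)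
Lemma integral_convolution_eq0 (K : R * R -> R) (P Q : R -> R) :
  (mu2).-integrable setT (EFin \o K) ->
  measurable_fun setT P -> measurable_fun setT Q ->
  (forall t, P t != 0 -> 0 < Q t)%R ->
  mu.-integrable setT (fun t => (P t / Q t)%:E) ->
  {ae mu2, forall z,
    mu.-integrable setT (fun t => (P t * K (Q t * z.1, z.2 + t))%:E) ->
    (\int[mu]_t (P t * K (Q t * z.1, z.2 + t)))%R = 0%R} ->
  (\int[mu]_t (P t / Q t)%:E) * \int[mu2]_z (K z)%:E = 0.
Proof.
move=> iK mP mQ PQ iPQ h0.
have mK : measurable_fun setT K by apply/measurable_EFinP; exact: measurable_int iK.
pose f (w : R * R * R) := (P w.2 * K (Q w.2 * w.1.1, w.1.2 + w.2))%:E.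
have mf : measurable_fun setT f.
  apply/measurable_EFinP; apply: measurable_funM; first exact: measurableT_comp.
  apply: (measurableT_comp mK); apply/measurable_fun_pairP; split => /=.
    by apply: measurable_funM; apply: measurableT_comp.
  by apply: measurable_funD => //; apply: measurableT_comp.
have fE t : \int[mu2]_z f (z, t) = (P t / Q t)%:E * \int[mu2]_z (K z)%:E.
  have [P0|/PQ Q0] := eqVneq (P t) 0%R.
    rewrite P0 mul0r mul0e; under eq_integral do rewrite /f/= P0 mul0r.
    exact: integral0.
  rewrite EFinM -muleA -(integral_affine2 t Q0 iK) -integralZl//.
  exact: integrable_affine2 iK.
(* The same factorization for absolute values gives joint integrability by Tonelli. *)
have absfE t : \int[mu2]_z `|f (z, t)| =
    `|(P t / Q t)%:E| * \int[mu2]_z `|(K z)%:E|.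
  have [P0|/PQ Q0] := eqVneq (P t) 0%R.
    rewrite P0 mul0r abse0 mul0e; under eq_integral do rewrite /f/= P0 mul0r normr0.
    exact: integral0.
  rewrite EFinM abseM (gee0_abs (_ : 0 <= (Q t)^-1%:E)) ?lee_fin ?invr_ge0 ?ltW//.
  have mabs : measurable_fun [set: R * R] (abse \o (EFin \o K)).
    by apply: measurableT_comp => //; exact: measurable_int iK.
  rewrite -muleA -(@ge0_integral_affine2 _ (Q t) t (abse \o (EFin \o K)))//; last first.
    by move=> x /=.
  rewrite -ge0_integralZl//.
  - by apply: eq_integral => z _; rewrite /f EFinM abseM.
  - apply: (measurableT_comp mabs); apply/measurable_fun_pairP; split.
      exact: measurable_funM.
    exact: measurable_funD.
  - by move=> z _ /=.
have intf : (mu2 \x mu).-integrable setT f.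
  have [_ ] := integrable21ltyP (f := f) mu2 mu mf; apply.
  under eq_integral do rewrite absfE.
  have Kfin : \int[mu2]_z `|(K z)%:E| \is a fin_num.
    by rewrite ge0_fin_numE ?integral_ge0//; case/integrableP: iK.
  rewrite -(fineK Kfin) ge0_integralZr//.
  - rewrite muleC lte_mul_pinfty// ?lee_fin ?fine_ge0 ?integral_ge0//.
    by case/integrableP: iPQ.
  - by apply: measurableT_comp => //; exact: measurable_int iPQ.
  - by rewrite lee_fin fine_ge0 ?integral_ge0.
have Kfin := integrable_fin_num measurableT iK.
have <- : \int[mu]_t fubini_G mu2 f t =
    \int[mu]_t (P t / Q t)%:E * \int[mu2]_z (K z)%:E.
  rewrite /fubini_G; under eq_integral do rewrite fE.
  by rewrite -(fineK Kfin) integralZr.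
rewrite (integral21_prod_meas1 intf) -(integral12_prod_meas1 intf).
rewrite -[RHS](integral0 mu2 setT); apply: ae_eq_integral => //.
  exact: (measurable_fubini_F intf).
have := ae_integrable1 intf; move: h0.
 apply: (@filterS2 _ _ (ae_filter_ringOfSetsType _)) => z h0 iz _.
rewrite /fubini_F -[LHS]fineK; last exact: integrable_fin_num.
by rewrite [X in X%:E](h0 iz).
Qed.

End convolution.

(** * Differentiable functions map null sets to null sets *)

Section lusin.
Variable R : realType.
Local Notation mu := (@lebesgue_measure R).
Local Notation l := (@wlength R idfun).

(** Cover [E] by short open intervals of small total length. The part of [E] in one of them is
    mapped into an interval at most 2L times as long. *)
Lemma negligible_image_lipschitz (E : set R) (f : R -> R) (d L : R) :
  0 < d -> 0 <= L -> mu.-negligible E ->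
  (forall x z, E x -> E z -> `|z - x| < d -> `|f z - f x| <= L * `|z - x|) ->
  mu.-negligible (f @` E).
Proof.
move=> d0 L0 /negligible_outer_measure E0 lip; apply/negligible_outer_measure.
apply/eqP; rewrite eq_le outer_measure_ge0 andbT.
apply/lee_addgt0Pr => e e0; rewrite add0e.
(* The first bound makes each covering interval shorter than [d], the second bounds the total length
   of the images by [e]; the summand 1 keeps the denominator positive when L = 0. *)
pose e' := Num.min d (e / (L *+ 2 + 1)).
have L1 : 0 < L *+ 2 + 1 by rewrite ltr_wpDl ?mulrn_wge0.
have e'0 : 0 < e' by rewrite lt_min d0 divr_gt0.
have [F [FI EF] Fe] : exists2 F, open_itv_cover E F & (\sum_(k <oo) l (F k) < e'%:E)%E.
  have : ((l^* E)%mu < e'%:E)%E by rewrite E0 lte_fin.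
  by rewrite outer_measure_open_itv_cover => /ereal_inf_lt[_ [F EF <-] ?]; exists F.
have l0 k : (0 <= l (F k))%E by exact: wlength_ge0.
have image_le k : ((l^* (f @` (E `&` F k)))%mu <= (L *+ 2)%:E * l (F k))%E.
  have [[p [Ep Fp]]|/forallNP Fk0] := pselect (exists p, E p /\ F k p); last first.
    rewrite (_ : E `&` F k = set0) ?image_set0 ?outer_measure0.
      by rewrite mule_ge0// lee_fin mulrn_wge0.
    by apply/seteqP; split => [x /Fk0|].
  have lk : (l (F k) < d%:E)%E.
    have lF := @nneseries_lim_ge R (fun k => l (F k)) xpredT 0 k.+1 (fun n _ _ => l0 n).
    have Fd : (l (F k) < e'%:E)%E.
      apply: le_lt_trans Fe; apply: le_trans lF.
      by rewrite big_nat_recr//= leeDr// sume_ge0.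
    by rewrite (lt_le_trans Fd)// lee_fin ge_min lexx.
  have [[a b] Fab] := FI k; move: Fp lk; rewrite Fab/= in_itv/= => /andP[ap pb].
  have ab := lt_trans ap pb.
  rewrite wlength_itv/= lte_fin ab -EFinB lte_fin => abd.
  set D := L * (b - a).
  have sub : f @` (E `&` `]a, b[) `<=` `[f p - D, f p + D].
    move=> _ [z [Ez +] <-]; rewrite /= !in_itv/= => /andP[az zb].
    have zp : `|z - p| < b - a by rewrite ltr_norml; lra.
    rewrite -ler_distl (le_trans (lip _ _ Ep Ez _)) ?(lt_trans zp)//.
    by rewrite ler_wpM2l// ltW.
  apply: (@le_trans _ _ (mu `[f p - D, f p + D])); first exact: le_outer_measure.
  have D0 : 0 <= D by rewrite mulr_ge0// subr_ge0 ltW.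
  rewrite lebesgue_measure_itv/= lte_fin; case: ifPn => _.
    by rewrite -EFinD lee_fin /D; lra.
  by rewrite lee_fin mulr_ge0 ?mulrn_wge0// subr_ge0 ltW.
apply: (@le_trans _ _ (\sum_(k <oo) (l^* (f @` (E `&` F k)))%mu)%E).
  apply: le_trans (outer_measure_sigma_subadditive _ _).
  apply: le_outer_measure => _ [x Ex <-]; have [k _ Fkx] := EF _ Ex.
  by exists k => //; exists x.
apply: (@le_trans _ _ (\sum_(k <oo) ((L *+ 2)%:E * l (F k)))%E).
  by apply: lee_nneseries => // k _ _; exact: outer_measure_ge0.
rewrite nneseriesZl//.
apply: (@le_trans _ _ ((L *+ 2)%:E * e'%:E)%E).
  by rewrite lee_wpmul2l ?lee_fin ?mulrn_wge0// ltW.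
rewrite -EFinM lee_fin.
apply: (@le_trans _ _ ((L *+ 2 + 1) * (e / (L *+ 2 + 1)))).
  by apply: ler_pM; rewrite ?mulrn_wge0 ?(ltW e'0) ?lerDl// ge_min lexx orbT.
by rewrite mulrC divfK// gt_eqF.
Qed.

(** Differentiability at each point splits [E] into countably many pieces [En n], on each of which
    [f] is Lipschitz at a fixed scale. *)
Lemma negligible_image_derivable (E : set R) (f : R -> R) :
  mu.-negligible E -> (forall x, E x -> derivable f x 1) ->
  mu.-negligible (f @` E).
Proof.
move=> E0 df.
pose En n := [set x | E x /\ forall z, `|z - x| < n.+1%:R^-1 ->
                        `|f z - f x| <= n.+1%:R * `|z - x|].
have EE : E `<=` \bigcup_n En n.
  move=> x Ex; have /cvg_ex[l' fl] := df x Ex.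
  (* Tolerance 1 bounds the difference quotients within some radius r by |l'| + 1; n + 1 is then
     taken beyond both 1/r and this bound. *)
  have /cvgrPdist_lt/(_ 1 ltr01) := fl.
  rewrite near_withinE => /nbhs_ballP[r /= r0 rl].
  have [n nr nl] : exists2 n : nat, n.+1%:R^-1 < r & `|l'| + 1 <= n.+1%:R.
    exists (maxn (Num.truncn r^-1) (Num.truncn (`|l'| + 1))).
      rewrite invf_plt ?posrE//.
      rewrite (lt_le_trans (truncnS_gt _))// ler_nat ltnS leq_maxl//.
    rewrite (le_trans (ltW (truncnS_gt _)))// ler_nat ltnS leq_maxr//.
  exists n => //; split => // z zx.
  have [->|zx0] := eqVneq z x; first by rewrite !subrr normr0 mulr0.
  have := rl (z - x); rewrite /ball/= sub0r normrN (lt_trans zx nr) => /(_ isT).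
  rewrite subr_eq0 => /(_ zx0); rewrite scaler1 subrK => fzl.
  have zx_gt0 : 0 < `|z - x| by rewrite normr_gt0 subr_eq0.
  rewrite -ler_pdivrMr// mulrC -normfV -normrM.
  apply: le_trans nl; rewrite -lerBlDl.
  by rewrite (le_trans (lerB_dist _ _))// distrC ltW.
suff : mu.-negligible (\bigcup_n (f @` En n)).
  apply: negligibleS.
  by move=> _ [x /EE[n _ Enx] <-]; exists n => //; exists x.
apply: negligible_bigcup => n.
apply: (@negligible_image_lipschitz _ _ n.+1%:R^-1 n.+1%:R) => //.
  by apply: negligibleS E0 => x [].
by move=> x z [_ +] _; exact.
Qed.

End lusin.

(** * Positivity and continuity of [q1] *)

Section q1_theory.
Variable R : realType.
Implicit Types x c : R.

Let num x c : R := x ^+ 2 - (1 - c ^+ 2).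
Let den x c : R := Num.sqrt (x ^+ 2 + (c + 1) ^+ 2) * Num.sqrt (x ^+ 2 + (1 - c) ^+ 2).

Let den_gt0 x c : Iset c -> 0 < den x c.
Proof.
rewrite /Iset/= in_itv/= => /andP[c1 c2].
by rewrite mulr_gt0// sqrtr_gt0 ltr_wpDl ?sqr_ge0// exprn_gt0//; lra.
Qed.

(** Lagrange's identity for the vectors (x, c + 1) and (x, c - 1): [num] is their scalar product,
    [den] the product of their norms, and 2x their determinant up to sign. So num / den is the
    cosine of an angle, and [q1] the cosine of half that angle. *)
Let sqr_num_den x c : num x c ^+ 2 = den x c ^+ 2 - (2 * x) ^+ 2.
Proof.
rewrite exprMn !sqr_sqrtr ?addr_ge0 ?sqr_ge0// /num.
ring.
Qed.

Lemma q1_ge0 x c : 0 <= q1 x c.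
Proof. by rewrite mulr_ge0 ?invr_ge0 ?sqrtr_ge0. Qed.

(** The identity gives |num| < den for x != 0. At x = 0 the quotient is -1 and [q1] vanishes. *)
Lemma q1_gt0 x c : Iset c -> x != 0 -> 0 < q1 x c.
Proof.
move=> Ic x0; rewrite mulr_gt0 ?invr_gt0 ?sqrtr_gt0//.
rewrite -ltrBlDl sub0r ltr_pdivlMr ?den_gt0// mulN1r.
suff : `|num x c| < den x c by rewrite ltr_norml => /andP[].
rewrite -ltr_sqr ?nnegrE ?(ltW (den_gt0 _ _))// real_normK ?num_real//.
by rewrite sqr_num_den ltrBlDr ltrDl exprn_even_gt0//= mulf_neq0.
Qed.

Lemma continuous_q1 c : Iset c -> continuous (fun x => q1 x c).
Proof.
move=> Ic x; apply: cvgMr.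
apply: continuous_cvg; first exact: sqrt_continuous.
have csqr (k : R) : {for x, continuous (fun y : R => Num.sqrt (y ^+ 2 + k))}.
  apply: continuous_cvg; first exact: sqrt_continuous.
  by apply: cvgD; [exact: exprn_continuous|exact: cvg_cst].
apply: cvgD; first exact: cvg_cst.
apply: cvgM.
  by apply: cvgB; [exact: exprn_continuous|exact: cvg_cst].
apply: cvgV; first by rewrite gt_eqF// (den_gt0 x Ic).
by apply: cvgM; exact: csqr.
Qed.

End q1_theory.

(** * Constant sign and nonzero integrals *)

Section sign.
Variable R : realType.
Local Notation mu := (@lebesgue_measure R).

(** The witness is f(0): a sign change between 0 and x would produce a zero by the intermediate
    value theorem. *)
Lemma continuous_neq0_sign (f : R -> R) : continuous f -> (forall x, f x != 0) ->
  exists2 s : R, s != 0 & forall x, 0 < s * f x.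
Proof.
move=> cf f0; exists (f 0) => // x; rewrite ltNge; apply/negP => fx.
pose a := Num.min 0 x; pose b := Num.max 0 x.
have ab : a <= b by rewrite ge_min le_max lexx.
have [|z _ fz] := @IVT _ f a b 0 ab (continuous_subspaceT cf).
  have : f a * f b <= 0.
    by rewrite /a /b; case: (leP 0 x) => // _; rewrite mulrC.
  rewrite ge_min le_max; case: (ltgtP (f a) 0) => fa; rewrite ?orbT//=.
    by rewrite nmulr_rle0// => ->.
  by rewrite pmulr_rle0// => ->.
by have := f0 z; rewrite fz eqxx.
Qed.

(** A nonnegative function with zero integral vanishes almost everywhere, but []0, w[] has positive
    measure. Leaving out t = 0 allows for the zero of [q1] there. *)
Lemma integral_neq0 (h : R -> R) (s w : R) : 0 < w ->
  mu.-integrable setT (EFin \o h) ->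
  (forall t, 0 <= s * h t) -> (forall t, 0 < t < w -> 0 < s * h t) ->
  (\int[mu]_t (h t)%:E != 0)%E.
Proof.
move=> w0 ih h0 hw; apply/eqP => ih0.
have ish : mu.-integrable setT (fun t => (s * h t)%:E).
  by under eq_fun do rewrite EFinM; exact: integrableZl.
have : (\int[mu]_t `|(s * h t)%:E| = 0)%E.
  under eq_integral do rewrite gee0_abs ?lee_fin// EFinM.
  by rewrite integralZl// ih0 mule0.
move/(ae_eq_integral_abs _ measurableT (measurable_int _ ish)) => [N [mN N0 subN]].
have : (mu `]0%R, w[%classic <= mu N)%E.
  apply: le_measure; rewrite ?inE// => t /=; rewrite in_itv/= => tw.
  by apply: subN => /= /(_ I) []; apply/eqP; rewrite gt_eqF// hw.
by rewrite N0 lebesgue_measure_itv/= lte_fin w0 oppr0 adde0 lee_fin leNgt w0.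
Qed.
End sign.

(** * Injectivity on a single fibre x2 = c *)

Section fiber.
Variable R : realType.
Local Notation mu := (@lebesgue_measure R).
Local Notation mu2 := (@leb2 R).

Lemma ae_eq_integrable d (T : measurableType d) (m : {measure set T -> \bar R})
    (f g : T -> \bar R) :
  measurable_fun setT f -> m.-integrable setT g -> ae_eq m setT f g ->
  m.-integrable setT f.
Proof.
move=> mf /integrableP[mg gi] fg; apply/integrableP; split => //.
rewrite (ae_eq_integral (abse \o g))//; try exact: measurableT_comp.
exact: ae_eq_abse.
Qed.

(** Here [p] stands for W2(., c), [k] for W1 and [w] for the width at c. *)
Lemma fiber_injective (g : R * R -> R) (Em EM A w c : R) (p k : R -> R) :
  0 < Em -> Iset c -> 0 < w ->
  continuous p -> (forall t, p t != 0) -> (forall E, 0 < E -> k E != 0) ->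
  mu2.-integrable setT (EFin \o g) ->
  (forall z, g z != 0 -> Em <= z.1 <= EM) ->
  {ae mu2, forall z, A < `|z.2| -> g z = 0} ->
  {ae mu2, forall z, 0 < z.1 ->
    \int[mu]_x (\1_(`[- w, w]%classic) (x - z.2) * (k z.1 * p (x - z.2)) *
                g (z.1 * q1 (x - z.2) c, x)) = 0} ->
  {ae mu2, forall z, g z = 0}.
Proof.
move=> Em0 Ic w0 cp p0 k0 ig gsupp gA gbragg.
have mg : measurable_fun setT g by apply/measurable_EFinP; exact: measurable_int ig.
have [s s0 sp] := continuous_neq0_sign cp p0.
pose Q t := q1 t c.
have cQ : continuous Q by exact: continuous_q1.
have Q0 t : t != 0 -> 0 < Q t by exact: q1_gt0.
have Qge0 t : 0 <= Q t by exact: q1_ge0.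
pose I : set R := `[- w, w]%classic.
(* [psi z = z.1^-1] on the support of [g], where [z.1 > 0]. *)
pose psi (z : R * R) := expR (- ln z.1).
have mpsi : measurable_fun setT psi.
  apply: (measurableT_comp (f := fun y : R => expR (- ln y))) => //.
  apply: measurableT_comp; first exact: measurable_expR.
  by apply: measurableT_comp => //; exact: measurable_ln.
(* The support of [g] is bounded in x only almost everywhere. The cutoff [b] supplies pointwise
   bounds for integrability and for the moment lemma, while [K0] keeps [g] uncut, as it occurs in
   [gbragg]. *)
pose b : R * R -> R := \1_(`[Em, EM] `*` `[- A, A]).
have mb : measurable_fun setT b by apply: measurable_indic; exact: measurableX.
pose v (z : R * R) : R := expR z.2.
have mv : measurable_fun setT v.
  by apply: measurableT_comp => //; exact: measurable_expR.
have psi_ge0 z : 0 <= psi z by exact: expR_ge0.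
have v_ge0 z : 0 <= v z by exact: expR_ge0.
have bE z : b z != 0 -> (Em <= z.1 <= EM) /\ `|z.2| <= A.
  rewrite /b indicE pnatr_eq0 eqb0 negbK inE => -[/=].
  by rewrite !in_itv/= -ler_norml.
have mK n m : measurable_fun setT (fun z => g z * (v z ^+ m * psi z ^+ n.+2)).
  by apply: measurable_funM => //; apply: measurable_funM; exact: measurable_funX.
have iK' n m : mu2.-integrable setT
    (fun z => (g z * (b z * (v z ^+ m * psi z ^+ n.+2)))%:E).
  apply: (@integrable_bounded_mul _ _ _ _ _ _ (expR A ^+ m * Em^-1 ^+ n.+2)) => //.
    by apply: measurable_funM => //; apply: measurable_funM; exact: measurable_funX.
  move=> z; have [->|bz] := eqVneq (b z) 0.
    by rewrite mul0r normr0 mulr_ge0// exprn_ge0// ?expR_ge0// invr_ge0 ltW.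
  have [/andP[z1 _] z2] := bE z bz.
  have -> : b z = 1 by move: bz; rewrite /b indicE; case: (_ \in _); rewrite ?eqxx.
  rewrite mul1r ger0_norm; last by apply: mulr_ge0; exact: exprn_ge0.
  apply: ler_pM; [exact: exprn_ge0|exact: exprn_ge0| |].
    by rewrite lerXn2r ?nnegrE ?expR_ge0// ler_expR (le_trans (ler_norm _)).
  rewrite lerXn2r ?nnegrE ?expR_ge0// ?invr_ge0 ?(ltW Em0)//.
  rewrite /psi expRN lnK ?posrE ?(lt_le_trans Em0)//.
  by rewrite lef_pV2 ?posrE// (lt_le_trans Em0).
have bae : {ae mu2, forall z, g z * b z = g z}.
  move: gA; apply: (@filterS _ _ (ae_filter_ringOfSetsType _)) => z gz.
  have [->|gz0] := eqVneq (g z) 0; first by rewrite mul0r.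
  rewrite /b indicE mem_set ?mulr1//; split => /=; rewrite in_itv/=.
    exact: gsupp.
  by rewrite -ler_norml leNgt; apply/negP => /gz; exact/eqP.
have KK' n m : ae_eq mu2 setT (fun z => (g z * (v z ^+ m * psi z ^+ n.+2))%:E)
    (fun z => (g z * (b z * (v z ^+ m * psi z ^+ n.+2)))%:E).
  move: bae; apply: (@filterS _ _ (ae_filter_ringOfSetsType _)) => z gz _.
  by rewrite [in RHS]mulrA gz.
have iK n m : mu2.-integrable setT
    (fun z => (g z * (v z ^+ m * psi z ^+ n.+2))%:E).
  apply: ae_eq_integrable (iK' n m) (KK' n m).
  by apply/measurable_EFinP; exact: mK.
(* The exponent [n + 2] makes [P] vanish at [t = 0], where [Q 0 = 0]. *)
pose P n m t := \1_I t * (p t * (expR (- t) ^+ m * Q t ^+ n.+2)).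
have cX (f : R -> R) n : continuous f -> continuous (fun t => f t ^+ n).
  move=> cf t; exact: (@continuous_comp _ _ _ f (fun y => y ^+ n) t (cf t)
    (@exprn_continuous _ n (f t))).
have ch m k' : continuous (fun t => p t * (expR (- t) ^+ m * Q t ^+ k')).
  have cexpN : continuous (fun t : R => expR (- t)).
    by move=> t; apply: continuous_cvg; [exact: continuous_expR|apply: cvgN; exact: cvg_id].
  move=> t; apply: cvgM; first exact: cp.
  by apply: cvgM; [exact: (cX _ m cexpN t)|exact: (cX _ k' cQ t)].
have mI : measurable I by exact: measurable_itv.
have mP n m : measurable_fun setT (P n m).
  apply: measurable_funM; first exact: measurable_indic.
  exact: continuous_measurable_fun (ch m n.+2).
have PQ n m t : P n m t / Q t = \1_I t * (p t * (expR (- t) ^+ m * Q t ^+ n.+1)).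
  (* At Q t = 0 both sides vanish, since the exponents are positive and the inverse of 0 is 0. *)
  rewrite /P; have [->|Qt] := eqVneq (Q t) 0.
    by rewrite !expr0n/= invr0 !mulr0.
  by rewrite exprSr; field.
have iPQ n m : mu.-integrable setT (fun t => (P n m t / Q t)%:E).
  have : mu.-integrable I (EFin \o (fun t => p t * (expR (- t) ^+ m * Q t ^+ n.+1))).
    apply: continuous_compact_integrable; first exact: segment_compact.
    exact: continuous_subspaceT (ch m n.+1).
  rewrite integrable_mkcond//; apply: eq_integrable => // t _.
  by rewrite PQ epatch_indic/= -EFinM mulrC.
have PQneq0 n m : (\int[mu]_t (P n m t / Q t)%:E != 0)%E.
  apply: (integral_neq0 (s := s) w0 (iPQ n m)).
  - move=> t; rewrite PQ [s * _]mulrCA; apply: mulr_ge0; first by rewrite indicE ler0n.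
    rewrite [s * _]mulrA; apply: mulr_ge0; first exact: ltW (sp t).
    by apply: mulr_ge0; apply: exprn_ge0 => //; exact: expR_ge0.
  - move=> t tw; rewrite PQ indicE mem_set ?mul1r; last first.
      by rewrite /I/= in_itv/=; lra.
    rewrite [s * _]mulrA mulr_gt0// mulr_gt0 ?exprn_gt0 ?expR_gt0// Q0// gt_eqF//.
    by case/andP: tw.
have K0 n m : (\int[mu2]_z (g z * (v z ^+ m * psi z ^+ n.+2))%:E = 0)%E.
  apply/eqP; have : ((\int[mu]_t (P n m t / Q t)%:E) *
      \int[mu2]_z (g z * (v z ^+ m * psi z ^+ n.+2))%:E == 0)%E.
    apply/eqP; apply: integral_convolution_eq0 => //.
    - exact: iK.
    - exact: continuous_measurable_fun cQ.
    - move=> t; rewrite lt0r Qge0 andbT; apply: contraNneq => Qt0.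
      by rewrite /P Qt0 expr0n/= !mulr0.
    - move: gbragg; apply: (@filterS _ _ (ae_filter_ringOfSetsType _)) => -[E x].
      rewrite /= => gE iPK.
      (* The transform is known only for E > 0; for E <= 0 the first argument of [g] is nonpositive,
         hence below [Em]. *)
      have [E0|E0] := ltP 0 E; last first.
        rewrite (_ : (fun t => _) = cst 0) ?Rintegral_cst ?mul0r//.
        apply/funext => t /=; rewrite (_ : g _ = 0) ?mul0r ?mulr0//.
        apply/eqP/contraT => /gsupp/= /andP[+ _].
        by rewrite leNgt (le_lt_trans _ Em0)// mulr_ge0_le0.
      (* Where [g] is nonzero, the powers of Q t and of exp t cancel between [P] and the kernel,
         leaving exp(m x) E^-(n+2); [C] replaces this factor by [k E]. *)
      pose C := k E / (expR x ^+ m * psi (E, x) ^+ n.+2).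
      have C0 : C != 0.
        by rewrite mulf_neq0 ?k0// invr_eq0 mulf_neq0 ?expf_neq0//= expR_eq0.
      apply: (mulfI C0); rewrite mulr0 -RintegralZl//.
      rewrite -[RHS](gE E0) /Rintegral; congr fine.
      rewrite [RHS](integral_translation x).
        apply: eq_integral => t _; congr EFin.
        rewrite addrK (addrC x t) (mulrC (Q t) E) -/(Q t) -/I.
        have [->|gEQ] := eqVneq (g (E * Q t, t + x)) 0; first by rewrite !(mul0r, mulr0).
        have Qt : 0 < Q t.
          rewrite lt0r Qge0 andbT; apply: contra_neq gEQ => Qt0; apply/eqP/contraT.
          by move/gsupp => /= /andP[+ _]; rewrite Qt0 mulr0 leNgt Em0.
        have EQt : 0 < E * Q t by exact: mulr_gt0.
        rewrite /C /P /v /psi/= !expRN expRD.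
        move: (Q t) (g _) Qt EQt {gEQ} => y gy y0 Ey0.
        rewrite !lnK ?posrE// !exprMn !exprVn exprMn.
        have := expf_neq0 m (lt0r_neq0 (expR_gt0 x)).
        have := expf_neq0 m (lt0r_neq0 (expR_gt0 t)).
        have := expf_neq0 n.+2 (lt0r_neq0 E0).
        have := expf_neq0 n.+2 (lt0r_neq0 y0).
        move: (expR x ^+ m) (expR t ^+ m) (E ^+ n.+2) (y ^+ n.+2) => e1 e2 e3 e4.
        by move=> *; field; do ?(apply/andP; split).
      apply: measurableT_comp => //; apply: measurable_funM.
        apply: measurable_funM.
          apply: (measurableT_comp (measurable_indic mI)).
          exact: measurable_funB.
        apply: measurable_funM => //.
        apply: (measurableT_comp (continuous_measurable_fun cp)).
        exact: measurable_funB.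
      apply: (measurableT_comp mg); apply/measurable_fun_pairP.
      split; last exact: measurable_id.
      apply: measurable_funM => //.
      apply: (measurableT_comp (continuous_measurable_fun cQ)).
      exact: measurable_funB.
  by rewrite mule_eq0 (negbTE (PQneq0 n m)).
have K'0 n m : (\int[mu2]_z (g z * (b z * (v z ^+ m * psi z ^+ n.+2)))%:E = 0)%E.
  rewrite -[RHS](K0 n m); apply/esym/ae_eq_integral => //.
  - exact: measurable_int (iK n m).
  - exact: measurable_int (iK' n m).
(* The positive factor psi^2 absorbs the offset in the exponent n + 2, so the moments start at order
   0. *)
have : {ae mu2, forall z, g z * b z * psi z ^+ 2 = 0}.
  apply: (@ae_eq0_moments _ _ Em EM A) => //.
  - have := iK' 0%N 0%N; apply: eq_integrable => // z _.
    by rewrite /= expr0 mul1r mulrA.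
  - move=> z nz; have [->|/bE//] := eqVneq (b z) 0; by rewrite mulr0 mul0r.
  - move=> n m; rewrite -[RHS](K'0 n m); apply: eq_integral => z _; congr EFin.
    have [->|bz] := eqVneq (b z) 0; first by rewrite !(mulr0, mul0r).
    have [/andP[z1 _] z2] := bE z bz.
    have z10 : 0 < z.1 by exact: lt_le_trans z1.
    rewrite /psi expRN lnK ?posrE// /v.
    by rewrite -exprVn -(addn2 n) exprD; ring.
move: bae; apply: (@filterS2 _ _ (ae_filter_ringOfSetsType _)) => z -> /eqP.
rewrite mulf_eq0 => /orP[/eqP//|].
by rewrite expf_eq0/= /psi expR_eq0.
Qed.

End fiber.

(** * Null sets and their sections in a product *)

Section ae_sections.
Context d1 d2 (T1 : measurableType d1) (T2 : measurableType d2) (R : realType).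
Variable m1 : {sigma_finite_measure set T1 -> \bar R}.
Variable m2 : {sigma_finite_measure set T2 -> \bar R}.
Local Open Scope ereal_scope.

(** The measures built from the two orders of integration agree on rectangles, hence coincide by
    uniqueness. *)
Lemma product_measure_ysection (N : set (T1 * T2)) : measurable N ->
  (m1 \x m2) N = \int[m2]_y m1 (ysection N y).
Proof.
move=> mN; transitivity ((m1 \x^ m2) N) => //.
by apply: product_measure_unique => // A B mA mB; exact: product_measure2E.
Qed.

Lemma ae_ysection (P : T1 * T2 -> Prop) :
  {ae m1 \x m2, forall z, P z} ->
  {ae m2, forall y, {ae m1, forall x, P (x, y)}}.
Proof.
move=> [N [mN N0 PN]].
have mNy := measurable_fun_ysection m1 mN.
have : \int[m2]_y `|(m1 \o ysection N) y| = 0.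
  under eq_integral do rewrite gee0_abs//=.
  by rewrite -product_measure_ysection.
move/(ae_eq_integral_abs _ measurableT mNy).
apply: (@filterS _ _ (ae_filter_ringOfSetsType _)) => y /(_ I) /= Ny0.
exists (ysection N y); split => //; first exact: measurable_ysection.
by move=> x Px; rewrite /ysection/= inE; apply: PN.
Qed.

(** Measurability of [A] lets the measure of its complement be computed from the sections, almost
    all of which are null. *)
Lemma ae_of_ysections (A : set (T1 * T2)) : measurable A ->
  {ae m2, forall y, {ae m1, forall x, A (x, y)}} ->
  {ae m1 \x m2, forall z, A z}.
Proof.
move=> mA hA; exists (~` A); split => //; first exact: measurableC.
rewrite product_measure_ysection; last exact: measurableC.
rewrite -[RHS](integral0 m2 setT); apply: ae_eq_integral => //.
  exact: measurable_fun_ysection (measurableC mA).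
move: hA; apply: (@filterS _ _ (ae_filter_ringOfSetsType _)) => y hy _.
apply/negligibleP; first by apply: measurable_ysection; exact: measurableC.
apply: negligibleS hy => x; rewrite /ysection/= inE.
by [].
Qed.

End ae_sections.

(** * Integrability of the data and change of the fibre variable *)

Section transfer.
Variable R : realType.
Local Notation mu := (@lebesgue_measure R).

(** Up to a null set, the support lies in a box of finite measure, on which |g| <= g^2 + 1.
    Compactness bounds the middle coordinate, the domain the other two. *)
Lemma L2_0_integrable (Em EM : R) (f : R * R * R -> R) :
  L2_0 (energy_domain Em EM) f ->
  (@leb3 R).-integrable setT (EFin \o (f \_ (energy_domain Em EM))) /\
  exists A : R, {ae @leb3 R, forall z,
    A < `|z.1.2| -> (f \_ (energy_domain Em EM)) z = 0}.
Proof.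
set D := energy_domain Em EM; set g := f \_ D.
move=> [L2 [K [cK KD fK]]].
have mg : measurable_fun setT g by move: L2; rewrite inE => /andP[]; rewrite inE.
have [A KA] : exists A, forall z, K z -> `|z.1.2| <= A.
  have [M [_ /(_ (M + 1))]] := compact_bounded cK.
  rewrite ltrDl ltr01 => /(_ isT) KM; exists (M + 1) => z /KM /=; apply: le_trans.
  by rewrite !prod_normE/= !le_max lexx orbT.
have gA : {ae @leb3 R, forall z, ~ K z -> g z = 0}.
  move: fK; apply: (@filterS _ _ (ae_filter_ringOfSetsType _)) => z Kz nKz.
  by rewrite /g /patch; case: ifPn => // /set_mem Dz; exact: Kz.
split; last first.
  exists A; move: gA; apply: (@filterS _ _ (ae_filter_ringOfSetsType _)) => z + zA.
  by apply => /KA; rewrite leNgt zA.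
pose B : set (R * R * R) := (`[Em, EM] `*` `[- A, A]) `*` `]-1, 1[.
have mB : measurable B by apply: measurableX => //; exact: measurableX.
have KB : K `<=` B.
  move=> z Kz; have [[zE _] zI] := KD _ Kz; split => //; split => //=.
  by rewrite in_itv/= -ler_norml KA.
have B_fin : (@leb3 R B < +oo)%E.
  have fin (a b : R) x y : mu [set` Interval (BSide x a) (BSide y b)] \is a fin_num.
    by rewrite lebesgue_measure_itv; case: ifP.
  have fin2 : (mu \x mu)%E (`[Em, EM] `*` `[- A, A]) \is a fin_num.
    by rewrite product_measure1E// fin_numM ?fin.
  rewrite /leb3 product_measure1E//; last exact: measurableX.
  by rewrite ltey_eq fin_numM ?fin.
have iB : (@leb3 R).-integrable setT (EFin \o (fun z => g z * \1_B z)).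
  have isum : (@leb3 R).-integrable setT (fun z => (g z ^+ 2)%:E + (\1_B z)%:E)%E.
    apply: integrableD => //; first exact: Lfun2_integrable_sqr.
    apply/integrableP; split; first by apply/measurable_EFinP; exact: measurable_indic.
    under eq_integral do rewrite gee0_abs//.
    by rewrite integral_indic// setIT.
  apply: (le_integrable measurableT _ _ isum).
  - by apply/measurable_EFinP; apply: measurable_funM => //; exact: measurable_indic.
  - move=> z _ /=; rewrite lee_fin (ger0_norm (_ : 0 <= g z ^+ 2 + _)); last first.
      by rewrite addr_ge0 ?sqr_ge0// indicE ler0n.
    rewrite normrM indicE; case: (_ \in _) => /=; last by rewrite normr0 mulr0 addr0 sqr_ge0.
    by rewrite normr1 mulr1 -real_normK ?num_real//; nra.
apply: ae_eq_integrable iB _; first exact/measurable_EFinP.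
move: gA; apply: (@filterS _ _ (ae_filter_ringOfSetsType _)) => z gz _ /=.
have [Kz|/gz ->] := pselect (K z); last by rewrite mul0r.
by rewrite indicE mem_set ?mulr1//; exact: KB.
Qed.

(** The exceptional set is contained in the image of a null set under the differentiable inverse
    [Psi]. *)
Lemma ae_comp_diffeo (A : set R) (Phi : R -> R) (P : R -> Prop) :
  diffeo_onto_image A Phi ->
  {ae mu, forall y, P y} -> {ae mu, forall x, A x -> P (Phi x)}.
Proof.
move=> [_ injPhi [dPsi _]] aeP.
pose Psi := 'pinv_(fun=> 0) A Phi.
pose E := [set y | (Phi @` A) y /\ ~ P y].
have : mu.-negligible (Psi @` E).
  apply: negligible_image_derivable.
    by apply: negligibleS aeP => y [].
  by move=> y [Ay _]; apply/derivable1_diffP; apply: dPsi; rewrite inE.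
apply: negligibleS => x /= /not_implyP[Ax nP]; exists (Phi x).
  by split => //; exists x.
by apply: pinvKV => //; rewrite inE.
Qed.

End transfer.

(** * From almost every fibre to the whole domain *)

Theorem theorem4p1 (R : realType) (Em EM beta : R)
  (hEm : 0 < Em) (hEM : Em < EM) (hbeta : 0 < beta < pi)
  (Phi : R -> R)
  (hPhi : diffeo_onto_image (@Iset R) Phi)
  (hPhiM : exists2 M : R, 0 < M & forall x2, Iset x2 -> 0 <= Phi x2 <= M)
  (W : R -> R -> R -> R) (W1 : R -> R) (W2 : R * R -> R)
  (hW : forall E x1 x2, Rpos E -> Iset x2 -> W E x1 x2 = W1 E * W2 (x1, x2))
  (hW1 : C1_on (@Rpos R) W1)
  (hW1nz : forall E, Rpos E -> W1 E != 0)
  (hW2 : C1_on (setT `*` @Iset R) W2)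
  (hW2nz : forall x1 x2, Iset x2 -> W2 (x1, x2) != 0)
  (hW2sym : forall x1 x2, Iset x2 -> W2 (- x1, x2) = W2 (x1, x2))
  (hW2C1 : forall x2, Iset x2 -> C1_on setT (fun x1 => W2 (x1, x2)))
  (hW2bd : forall x2, Iset x2 ->
     [bounded W2 (x1, x2) | x1 in `[- width beta x2, width beta x2]%classic])
  (hW2dbd : forall x2, Iset x2 ->
     [bounded derive1 (fun t => W2 (t, x2)) x1
       | x1 in `[- width beta x2, width beta x2]%classic]) :
  bragg_injective Em EM beta Phi W.
Proof.
move=> f fL2 fbragg.
set D := energy_domain Em EM; set g := f \_ D.
have [ig [A gA]] := L2_0_integrable fL2.
have mg : measurable_fun setT g by apply/measurable_EFinP; exact: measurable_int ig.
have gsupp z : g z != 0 -> D z.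
  by rewrite /g /patch; case: ifPn => [/set_mem//|]; rewrite eqxx.
have width_gt0 c : Iset c -> 0 < width beta c.
  rewrite /Iset/= in_itv/= => /andP[c1 c2].
  rewrite mulr_gt0//; first lra.
  by rewrite divr_gt0 ?sin_gt0_pihalf ?cos_gt0_pihalf//; move: hbeta; lra.
have igc := ae_integrable2 (m1 := @leb2 R) (m2 := @lebesgue_measure R) ig.
have gAc := ae_ysection (m1 := @leb2 R) gA.
have braggc := ae_comp_diffeo hPhi (ae_ysection (m1 := @leb2 R) fbragg).
(* The zero extension [g] agrees with [f] on [D] and is measurable, as reassembling the fibres
   requires. *)
suff : {ae @leb3 R, forall z, g z = 0}.
  apply: (@filterS _ _ (ae_filter_ringOfSetsType _)) => z + Dz.
  by rewrite /g /patch mem_set.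
apply: (@ae_of_ysections _ _ _ _ _ (@leb2 R) (@lebesgue_measure R) (g @^-1` [set 0])).
  by rewrite -[_ @^-1` _]setTI; exact: mg.
move: igc gAc braggc; apply: (@filterS3 _ _ (ae_filter_ringOfSetsType _)) => c ic Ac bc.
have [Ic|nIc] := pselect (Iset c); last first.
  by apply: aeW => x /=; apply/eqP/contraT => /gsupp[_ /=].
apply: (fiber_injective (g := fun z => g (z, c)) (EM := EM) (A := A) (p := fun t => W2 (t, c))
  (k := W1) hEm Ic (width_gt0 c Ic) _ _ _ ic _ Ac).
- move=> t; apply/differentiable_continuous.
  by have [+ _] := hW2C1 c Ic; apply; rewrite inE.
- by move=> t; exact: hW2nz.
- by move=> E E0; apply: hW1nz; rewrite /Rpos/= in_itv/= E0.
- by move=> z /gsupp[[/= + _] _]; rewrite in_itv; exact.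
- move: (bc Ic); apply: (@filterS _ _ (ae_filter_ringOfSetsType _)) => -[E s] /= bz E0.
  have RE : Rpos E by rewrite /Rpos/= in_itv/= E0.
  rewrite -[RHS]bz; last by split => //; exists c.
  (* The partial inverse in [bragg] returns c at Phi c because [Phi] is injective on the
     interval. *)
  rewrite /bragg/= pinvKV ?inE//; last by have [] := hPhi.
  by rewrite /bragg_fiber; apply: eq_Rintegral => x _; rewrite hW.
Qed.
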